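(* Let $2\le n\le\infty$. (i) For any state $\omega$ on $\mathcal{O}_n$, there exists a minimal state $\omega'$ on $\mathcal{O}_n$ which is equivalent to $\omega$, i.e. $\omega'\sim\omega$ (such an $\omega'$ is called a minimal model of $\omega$). (ii) For any states $\omega,\omega'$ on $\mathcal{O}_n$, if $\omega\sim\omega'$, then $\kappa(\omega)=\kappa(\omega')$.
   Context: For $2\le n\le\infty$, $\mathcal{O}_n$ is the Cuntz algebra with Cuntz generators $s_1,\ldots,s_n$ (a sequence $s_1,s_2,\ldots$ if $n=\infty$): the universal unital C*-algebra generated by elements with $s_i^*s_j=\delta_{ij}I$ and $\sum_{i=1}^n s_is_i^*=I$ if $n<\infty$, respectively $\sum_{i=1}^k s_is_i^*\le I$ for all $k\geq 1$ if $n=\infty$. When $n=\infty$, $\{1,\ldots,n\}$ means $\{1,2,\ldots\}$. Let $\mathcal{I}_n=\bigcup_{l\ge0}\{1,\ldots,n\}^l$ be the set of finite words, $\{1,\ldots,n\}^0=\{\emptyset\}$, $s_J=s_{j_1}\cdots s_{j_l}$ for $J=(j_1,\ldots,j_l)$, $s_\emptyset=I$. For states $\omega,\omega'$ on $\mathcal{O}_n$, write $\omega\sim\omega'$ (equivalent) if their GNS representations are unitarily equivalent. For a state $\omega$ with GNS representation $(\mathcal{H},\pi,\Omega)$, let $\mathcal{K}(\omega)$ be the closed linear span of $\{\pi(s_J)^*\Omega: J\in\mathcal{I}_n\}$ in $\mathcal{H}$, $\mathrm{c}\dim\omega:=\dim\mathcal{K}(\omega)\in\{1,2,\ldots,\infty\}$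 (Hilbert space dimension, $\infty$ meaning countably infinite), and $\kappa(\omega):=\min\{\mathrm{c}\dim\omega':\omega'\text{ a state on }\mathcal{O}_n,\ \omega'\sim\omega\}$. A state $\omega$ is minimal if $\mathrm{c}\dim\omega=\kappa(\omega)$. *)

(* Defs.v *)
From HB Require Import structures.
From mathcomp Require Import all_boot all_order all_algebra sesquilinear.
From mathcomp Require Import all_classical all_reals all_analysis.
From mathcomp Require Import complex.

Set Implicit Arguments.
Unset Strict Implicit.
Unset Printing Implicit Defensive.

Import Order.TTheory GRing.Theory Num.Theory.
Import numFieldNormedType.Exports.
Local Open Scope classical_set_scope.
Local Open Scope ring_scope.

(* [None] stands for infinity. *)
Notation natinf := (option nat).

Definition leinf (m n : natinf) : bool :=
  match m, n with
  | _, None => true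
  | None, Some _ => false
  | Some a, Some b => (a <= b)%N
  end.

Definition is_min (S : set natinf) (m : natinf) : Prop :=
  S m /\ forall k, S k -> leinf m k.

(* {1, ..., n}, or {1, 2, ...} if n is infinite, renumbered from 0. *)
Definition idx (n : natinf) : countType :=
  if n is Some m then ('I_m : countType) else (nat : countType).

(* Unital C*-algebras and Hilbert spaces over the complex numbers R[i]; the
   norm of a normed module over R[i] takes its values in R[i], where [0 <= z]
   means that z is real and nonnegative. *)
Record cstarAlg (R : realType) := CstarAlg {
  cs_carrier :> completeNormedModType R[i] ;
  cs_mul : cs_carrier -> cs_carrier -> cs_carrier ;
  cs_one : cs_carrier ;
  cs_star : cs_carrier -> cs_carrier ;
  cs_mulA : associative cs_mul ;
  cs_mul1l : left_id cs_one cs_mul ;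
  cs_mul1r : right_id cs_one cs_mul ;
  cs_linear_mull : forall b, linear (fun a => cs_mul a b) ;
  cs_linear_mulr : forall a, linear (cs_mul a) ;
  cs_starK : involutive cs_star ;
  cs_starD : forall a b, cs_star (a + b) = cs_star a + cs_star b ;
  cs_starZ : forall (k : R[i]) a,
    cs_star (k *: a) = Num.conj k *: cs_star a ;
  cs_starM : forall a b, cs_star (cs_mul a b) = cs_mul (cs_star b) (cs_star a) ;
  cs_normM : forall a b, `|cs_mul a b| <= `|a| * `|b| ;
  cs_norm_star : forall a, `|cs_mul (cs_star a) a| = `|a| ^+ 2
}.

Arguments cs_one {R A} : rename.

Notation "a ^*c" := (cs_star a) (at level 2, format "a ^*c").
Notation "a *c b" := (cs_mul a b) (at level 40, left associativity).

Record hilbertType (R : realType) := HilbertType {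
  h_carrier :> completeNormedModType R[i] ;
  (* linear in the first argument, conjugate linear in the second *)
  h_dot : {dot h_carrier for Num.conj} ;
  h_norm_dot : forall x, `|x| ^+ 2 = h_dot x x
}.

Notation "''[' x , y ]" := (h_dot _ x y) (format "''[' x ,  y ]") : ring_scope.

Definition cs_ge0 (R : realType) (A : cstarAlg R) (a : A) : Prop :=
  exists b : A, a = b^*c *c b.

Definition cs_le (R : realType) (A : cstarAlg R) (a b : A) : Prop :=
  cs_ge0 (b - a).

Definition is_star_morphism (R : realType) (A B : cstarAlg R) (f : A -> B) :
    Prop :=
  [/\ linear f,
      forall a b, f (a *c b) = f a *c f b,
      f cs_one = cs_one
    & forall a, f a^*c = (f a)^*c].

Section Cuntz.
Variables (R : realType) (n : natinf).

Definition cuntz_sum (A : cstarAlg R) : (idx n -> A) -> Prop :=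
  match n return (idx n -> A) -> Prop with
  | Some m => fun s => \sum_(i < m) s i *c (s i)^*c = cs_one
  | None => fun s => forall k, cs_le (\sum_(i < k) s i *c (s i)^*c) cs_one
  end.

Definition cuntz_relations (A : cstarAlg R) (s : idx n -> A) : Prop :=
  (forall i j, (s i)^*c *c s j = if i == j then cs_one else 0) /\ cuntz_sum s.

(* A is the Cuntz algebra O_n, with Cuntz generators s. *)
Definition is_cuntz_algebra (A : cstarAlg R) (s : idx n -> A) : Prop :=
  cuntz_relations s /\
  forall (B : cstarAlg R) (t : idx n -> B), cuntz_relations t ->
    exists! f : A -> B, is_star_morphism f /\ forall i, f (s i) = t i.

Definition word_prod (A : cstarAlg R) (s : idx n -> A) (J : seq (idx n)) : A :=
  foldr (fun j a => s j *c a) cs_one J.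

End Cuntz.

(* Positive linear functionals of norm one: the norm is at most one, and is
   attained at the unit. *)
Record state (R : realType) (A : cstarAlg R) := State {
  st_fun :> {scalar A} ;
  st_ge0 : forall a : A, 0 <= st_fun (a^*c *c a) ;
  st_norm : forall a : A, `|st_fun a| <= `|a| ;
  st_one : st_fun cs_one = 1
}.

Section HilbertSpaces.
Variables (R : realType) (H : hilbertType R).

Definition closed_span (S : set H) : set H :=
  closure [set x | exists (m : nat) (c : 'I_m -> R[i]) (v : 'I_m -> H),
    (forall i, S (v i)) /\ x = \sum_(i < m) c i *: v i].

Definition is_hilbert_basis (K : set H) (I : eqType) (e : I -> H) : Prop :=
  (forall i j, '[e i, e j] = (i == j)%:R) /\ closed_span (range e) = K.

Definition has_hilbert_dim (K : set H) (d : natinf) : Prop :=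
  exists e : idx d -> H, is_hilbert_basis K e.

End HilbertSpaces.

(* Unital *-representations by bounded operators; [rep_star] says that
   rep a^* is the adjoint of rep a. *)
Record representation (R : realType) (A : cstarAlg R) (H : hilbertType R) :=
  Representation {
  rep_op :> A -> {linear H -> H} ;
  rep_bounded : forall a, continuous (rep_op a) ;
  rep_linear : forall x, linear (fun a => rep_op a x) ;
  rep_mul : forall a b x, rep_op (a *c b) x = rep_op a (rep_op b x) ;
  rep_one : forall x, rep_op cs_one x = x ;
  rep_star : forall a x y, '[rep_op a x, y] = '[x, rep_op a^*c y]
}.

Definition unitarily_equivalent (R : realType) (A : cstarAlg R)
    (H H' : hilbertType R) (p : representation A H) (p' : representation A H') :
    Prop :=
  exists U : {linear H -> H'},
    [/\ forall y, exists x, U x = y,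
        forall x y, '[U x, U y] = '[x, y]
      & forall a x, U (p a x) = p' a (U x)].

(* GNS representations of w; they are unique up to unitary equivalence. *)
Record gns (R : realType) (A : cstarAlg R) (w : state A) := GNS {
  gns_space : hilbertType R ;
  gns_rep : representation A gns_space ;
  gns_vec : gns_space ;
  gns_cyclic : closure (range (fun a => gns_rep a gns_vec)) = setT ;
  gns_state : forall a, w a = '[gns_rep a gns_vec, gns_vec]
}.

Definition equivalent (R : realType) (A : cstarAlg R) (w w' : state A) : Prop :=
  exists (G : gns w) (G' : gns w'),
    unitarily_equivalent (gns_rep G) (gns_rep G').

Section CorrelationDimension.
Variables (R : realType) (n : natinf) (A : cstarAlg R) (s : idx n -> A).

(* The operator pi(s_J)^* is written pi(s_J^* ). *)
Definition corr_space (w : state A) (G : gns w) : set (gns_space G) :=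
  closed_span (range (fun J => gns_rep G (word_prod s J)^*c (gns_vec G))).

Arguments corr_space {w} G.

(* The defining property below holds for exactly one d: GNS representations
   exist, they are unique up to unitary equivalence, and [corr_space G] is
   separable. *)
Definition cdim (w : state A) : natinf :=
  xget None [set d | exists G : gns w, has_hilbert_dim (corr_space G) d].

Definition kappa (w : state A) : natinf :=
  xget None [set k | is_min [set cdim w' | w' in [set w' | equivalent w' w]] k].

Definition minimal (w : state A) : Prop := cdim w = kappa w.

End CorrelationDimension.

(* Main.v *)
Require Import Defs.
From HB Require Import structures.
From mathcomp Require Import all_boot all_order all_algebra sesquilinear.
From mathcomp Require Import all_classical all_reals all_analysis.
From mathcomp Require Import complex.
From mathcomp Require Import ring lra.

(** The statement holds because equivalence of states is an equivalence
    relation, and because dimensions, taken in the natural numbers with an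
    infinity added, are well ordered. The set of all [cdim w'] with [w']
    equivalent to [w] then depends only on the class of [w], which is the
    invariance of [kappa]; it contains [cdim w], so it has a least element, and
    any state attaining it is a minimal model of [w].

    Two facts about GNS representations are hidden in this. Two states are
    equivalent when some GNS representation of one is unitarily equivalent to
    some GNS representation of the other. Hence reflexivity says that a GNS
    representation exists ([gns_exists]), and transitivity needs any two GNS
    representations of one state to be unitarily equivalent ([gns_unique]).

    Existence. The form [w (b^* a)] is a semi-inner product on the algebra. Its
    Hausdorff completion is realized without quotients or Cauchy sequences: a
    vector [f] of the Hilbert space is determined by the antilinear functional
    sending [b] to the inner product of [f] with the class of [b], so the
    completion is taken to be the set of those functionals that are limits, in
    the operator norm, of the functionals given by elements of the algebra. It is
    complete because bounded functionals are, and its inner product is defined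
    from its norm by the polarization formula; sesquilinearity passes from the
    dense image of the algebra to its limits ([polar_linear_lim]). An element [a]
    acts by precomposition with left multiplication by [a^*]. That this is bounded
    is the inequality [w (x^* a^* a x) <= |a|^2 w (x^* x)] ([gns_form_bound]),
    which follows by iterating Cauchy-Schwarz, with no functional calculus.

    Uniqueness. The pairs (limit of [p (t n) v], limit of [p' (t n) v']), over
    sequences [t] in the algebra for which both limits exist, form the graph of
    a unitary intertwiner, because inner products of orbit vectors are determined
    by the state ([gns_graph_dot]). *)

Set Implicit Arguments.
Unset Strict Implicit.
Unset Printing Implicit Defensive.

Import Order.TTheory GRing.Theory Num.Theory.
Import numFieldNormedType.Exports.
Local Open Scope classical_set_scope.
Local Open Scope ring_scope.
Local Open Scope complex_scope.

(** * Semi-inner products *)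

Section SemiInner.
Context (R : realType) (V : lmodType R[i]).

Record semi_inner := SemiInner {
  si_fun :> V -> V -> R[i] ;
  si_linearl : forall a x y z,
    si_fun (a *: x + y) z = a * si_fun x z + si_fun y z ;
  si_linearr : forall a x y z,
    si_fun z (a *: x + y) = Num.conj a * si_fun z x + si_fun z y ;
  si_ge0 : forall x, 0 <= si_fun x x
}.

Variable B : semi_inner.

Lemma si0l z : B 0 z = 0.
Proof.
have := si_linearl B 1 0 0 z; rewrite scale1r addr0 mul1r => /eqP.
by rewrite -subr_eq subrr eq_sym => /eqP.
Qed.

Lemma si0r z : B z 0 = 0.
Proof.
have := si_linearr B 1 0 0 z; rewrite scale1r addr0 rmorph1 mul1r => /eqP.
by rewrite -subr_eq subrr eq_sym => /eqP.
Qed.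

Lemma siDl x y z : B (x + y) z = B x z + B y z.
Proof. by have := si_linearl B 1 x y z; rewrite scale1r mul1r. Qed.

Lemma siDr x y z : B z (x + y) = B z x + B z y.
Proof. by have := si_linearr B 1 x y z; rewrite scale1r rmorph1 mul1r. Qed.

Lemma siZl a x z : B (a *: x) z = a * B x z.
Proof. by have := si_linearl B a x 0 z; rewrite !addr0 si0l addr0. Qed.

Lemma siZr a x z : B z (a *: x) = Num.conj a * B z x.
Proof. by have := si_linearr B a x 0 z; rewrite !addr0 si0r addr0. Qed.

Lemma siNl x z : B (- x) z = - B x z.
Proof. by rewrite -scaleN1r siZl mulN1r. Qed.

Lemma siNr x z : B z (- x) = - B z x.
Proof. by rewrite -scaleN1r siZr rmorphN1 mulN1r. Qed.

Definition siE := (siDl, siDr, siNl, siNr, siZl, siZr).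

(** The values at [x + y] and [x + i y] are real. *)
Lemma si_conj x y : B y x = Num.conj (B x y).
Proof.
have Im0 z : complex.Im (B z z) = 0 by apply: complex.ger0_Im; exact: si_ge0.
have h1 := Im0 (x + y); have h2 := Im0 (x + 'i *: y).
move: h1 h2; rewrite !siE; move: (Im0 x) (Im0 y).
case: (B x x) => [a1 a2]; case: (B y y) => [b1 b2].
case: (B x y) => [c1 c2]; case: (B y x) => [d1 d2] /= -> ->.
move=> h1 h2; apply/eqP; rewrite eq_complex /=; apply/andP; split; apply/eqP; lra.
Qed.

Lemma si_polarization x y : B x y =
  (B (x + y) (x + y) - B (x - y) (x - y) + 'i * B (x + 'i *: y) (x + 'i *: y)
    - 'i * B (x - 'i *: y) (x - 'i *: y)) / 4.
Proof.
have ii z : 'i * ('i * z) = - z :> R[i] by rewrite mulrA -expr2 sqrCi mulN1r.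
by rewrite !siE conjCi !(mulrDr, mulrN, mulNr) !ii; field.
Qed.

(** Nonnegativity at [x - s <x,y> y] for a real [s] >= 0. In the degenerate case
    [<y,y> = 0] the bound is linear in [s], so that [<x,y>] has to vanish. *)
Lemma si_CauchySchwarz x y : `|B x y| ^+ 2 <= B x x * B y y.
Proof.
have key s : 0 <= s ->
    0 <= B x x - s * `|B x y| ^+ 2 *+ 2 + s ^+ 2 * `|B x y| ^+ 2 * B y y.
  move=> s0; have := si_ge0 B (x - (s * B x y) *: y).
  rewrite !siE (si_conj x y) rmorphM /= (geC0_conj s0) => /le_trans; apply.
  rewrite le_eqVlt; apply/orP; left; apply/eqP.
  by rewrite normCK; ring.
have m0 : 0 <= `|B x y| ^+ 2 by rewrite exprn_ge0.
have [b0|b0] := eqVneq (B y y) 0; last first.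
  have bp : 0 < B y y by rewrite lt_def b0 si_ge0.
  (* the minimum over s *)
  have := key (B y y)^-1; rewrite invr_ge0 => /(_ (ltW bp)).
  rewrite [X in 0 <= X](_ : _ = B x x - `|B x y| ^+ 2 / B y y); last by field.
  by rewrite subr_ge0 ler_pdivrMr.
have [->|mn0] := eqVneq (`|B x y| ^+ 2) 0; first by rewrite mulr_ge0 ?si_ge0.
(* for this s the bound reads 0 <= - (<x,x> + 2) *)
have s0 : 0 <= (B x x + 1) / `|B x y| ^+ 2 by rewrite divr_ge0 ?addr_ge0 ?si_ge0.
move: (key _ s0); rewrite b0 mulr0 addr0 divfK //.
rewrite [X in 0 <= X](_ : _ = - (B x x + 2)); last by ring.
have lt0 : 0 < B x x + 2 by rewrite ltr_wpDl ?si_ge0.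
by rewrite oppr_ge0 => /(lt_le_trans lt0); rewrite ltxx.
Qed.

Definition si_norm (u : V) : R[i] := sqrtC (B u u).

Lemma si_norm_ge0 u : 0 <= si_norm u.
Proof. by rewrite sqrtC_ge0 si_ge0. Qed.

Lemma si_normK u : si_norm u ^+ 2 = B u u.
Proof. exact: sqrtCK. Qed.

Lemma si_CauchySchwarz_sqrt x y : `|B x y| <= si_norm x * si_norm y.
Proof.
rewrite -(@ler_pXn2r _ 2) ?nnegrE ?mulr_ge0 ?si_norm_ge0 //.
by rewrite exprMn !si_normK si_CauchySchwarz.
Qed.

End SemiInner.

(** * The Hausdorff completion of a semi-inner product space *)

Lemma nneg_realE (R : realType) (z : R[i]) : 0 <= z -> z = (complex.Re z)%:C.
Proof. by move=> z0; rewrite RRe_real // ger0_real. Qed.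

Section Completion.
Context (R : realType) (V : lmodType R[i]) (B : semi_inner V).
Local Notation nrm := (si_norm B).

(** The functionals [f] in the closure of the [B v]. Antilinearity is not
    imposed: it is inherited from the [B v]. *)
Definition approximable (f : V -> R[i]) := forall e : R[i], 0 < e ->
  exists v, forall u, `|f u - B v u| <= e * nrm u.

Definition approximable_pred : {pred V -> R[i]} := fun f => `[< approximable f >].

Lemma approximable_submod_closed : submod_closed approximable_pred.
Proof.
split.
  by apply/asboolP => e e0; exists 0 => u; rewrite si0l subrr normr0
    mulr_ge0 ?si_norm_ge0 // ltW.
move=> a f g /asboolP fP /asboolP gP; apply/asboolP => e e0.
have a1 : 0 < `|a| + 1 by rewrite ltr_wpDl.
have e1 : 0 < e / (`|a| + 1) / 2 by rewrite !divr_gt0.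
have [v hv] := fP _ e1; have [w hw] := gP _ (divr_gt0 e0 (ltr0Sn _ 1)).
exists (a *: v + w) => u; rewrite si_linearl /=.
have -> : (a *: f + g) u - (a * B v u + B w u) =
   a * (f u - B v u) + (g u - B w u).
  by rewrite [(a *: f + g) u](_ : _ = a * f u + g u) //; ring.
rewrite (le_trans (ler_normD _ _)) // normrM.
rewrite [e in leRHS](splitr e) mulrDl lerD //.
rewrite (le_trans (ler_wpM2l (normr_ge0 a) (hv u))) //.
rewrite mulrA ler_wpM2r ?si_norm_ge0 //.
rewrite [leLHS](_ : _ = (`|a| / (`|a| + 1)) * (e / 2)); last by ring.
by rewrite ler_piMl ?divr_ge0 ?(ltW e0) // ler_pdivrMr // mul1r lerDl.
Qed.

HB.instance Definition _ := GRing.isSubmodClosed.Build _ _ approximable_pred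
  approximable_submod_closed.

Record completion := Completion {
  cpl_fun :> V -> R[i] ;
  cpl_approx : cpl_fun \in approximable_pred
}.

HB.instance Definition _ := [isSub for cpl_fun].
HB.instance Definition _ := [Choice of completion by <:].
HB.instance Definition _ := [SubChoice_isSubLmodule of completion by <:].

Lemma cplP (f : completion) : approximable f.
Proof. by apply/asboolP; exact: cpl_approx. Qed.

Lemma cpl_eq (f g : completion) : f =1 g -> f = g.
Proof. by move=> fg; apply/val_inj/funext. Qed.

Lemma cplZ a (f : completion) u : (a *: f) u = a * f u.
Proof. by []. Qed.
Lemma cpl0 u : (0 : completion) u = 0.
Proof. by []. Qed.

(** The norm is the best constant in a bound; it is an infimum in [R], where
    infima exist, cast to [R[i]], where norms live. *)
Definition bounds (f : completion) : set R :=
  [set M | 0 <= M /\ forall u, `|f u| <= M%:C * nrm u].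

Lemma bounds_has_inf f : has_inf (bounds f).
Proof.
split; last by exists 0 => M [].
(* an approximation of f up to 1 is bounded by Cauchy-Schwarz *)
have [v hv] := cplP f (@ltr01 _).
have h : 0 <= 1 + nrm v by rewrite addr_ge0 ?si_norm_ge0.
exists (complex.Re (1 + nrm v)); split.
  by rewrite -ler0c -nneg_realE.
move=> u; rewrite -nneg_realE // -[f u](subrK (B v u)).
by rewrite (le_trans (ler_normD _ _)) // mulrDl lerD ?hv // si_CauchySchwarz_sqrt.
Qed.

Definition cpl_norm (f : completion) : R[i] := (inf (bounds f))%:C.

Lemma cpl_norm_ge0 f : 0 <= cpl_norm f.
Proof.
rewrite ler0c; apply: lb_le_inf; first by have [] := bounds_has_inf f.
by move=> M [].
Qed.

(** If [nrm u] is not zero, [|f u| / nrm u] is a lower bound of [bounds f]. *)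
Lemma cpl_normP (f : completion) u : `|f u| <= cpl_norm f * nrm u.
Proof.
rewrite /cpl_norm (nneg_realE (normr_ge0 (f u))) (nneg_realE (si_norm_ge0 B u)).
set a := complex.Re _; set b := complex.Re _.
have b0 : 0 <= b by rewrite -ler0c -nneg_realE ?si_norm_ge0.
rewrite -rmorphM lecR.
have leM M : bounds f M -> a <= M * b.
  case=> _ /(_ u).
  rewrite (nneg_realE (normr_ge0 (f u))) (nneg_realE (si_norm_ge0 B u)).
  by rewrite -rmorphM lecR.
have [[M0 hM0] _] := bounds_has_inf f.
move: b0; rewrite le_eqVlt => /predU1P[b0|b0].
  by have := leM _ hM0; rewrite -b0 !mulr0.
rewrite -ler_pdivrMr //; apply: lb_le_inf; first by exists M0.
by move=> M hM; rewrite ler_pdivrMr // leM.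
Qed.

Lemma cpl_norm_le (f : completion) (M : R[i]) :
  0 <= M -> (forall u, `|f u| <= M * nrm u) ->
  cpl_norm f <= M.
Proof.
move=> M0 hM; rewrite (nneg_realE M0) lecR; apply: ge_inf.
  by have [] := bounds_has_inf f.
by split; [rewrite -ler0c -nneg_realE|move=> u; rewrite -nneg_realE].
Qed.

Lemma cpl_normD (f g : completion) : cpl_norm (f + g) <= cpl_norm f + cpl_norm g.
Proof.
apply: cpl_norm_le => [|u]; first by rewrite addr_ge0 ?cpl_norm_ge0.
by rewrite (le_trans (ler_normD _ _)) // mulrDl lerD ?cpl_normP.
Qed.

Lemma cpl_normZ a (f : completion) : cpl_norm (a *: f) = `|a| * cpl_norm f.
Proof.
have le b g : cpl_norm (b *: g) <= `|b| * cpl_norm g.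
  apply: cpl_norm_le => [|u]; first by rewrite mulr_ge0 ?cpl_norm_ge0.
  by rewrite cplZ normrM -mulrA ler_wpM2l ?cpl_normP.
apply/eqP; rewrite eq_le le /=.
have [->|a0] := eqVneq a 0; first by rewrite normr0 mul0r cpl_norm_ge0.
have := le a^-1 (a *: f); rewrite scalerA mulVf // scale1r normfV.
by rewrite -ler_pdivrMl ?invr_gt0 ?normr_gt0 // invrK.
Qed.

Lemma cpl_norm_eq0 (f : completion) : cpl_norm f = 0 -> f = 0.
Proof.
move=> f0; apply: cpl_eq => u; apply/eqP; rewrite cpl0 -normr_le0.
by have := cpl_normP f u; rewrite f0 mul0r.
Qed.

HB.instance Definition _ :=
  Lmodule_isNormed.Build R[i] completion cpl_normD cpl_normZ cpl_norm_eq0.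

Lemma cpl_normE (f : completion) : `|f| = cpl_norm f.
Proof. by []. Qed.

(** The defect is at most [e M] for every [e > 0], with [M] depending only on
    [k], [x] and [y]. *)
Lemma cpl_antilinear (f : completion) k x y :
  f (k *: x + y) = Num.conj k * f x + f y.
Proof.
apply/eqP; rewrite -subr_eq0 -normr_le0; apply/ler_addgt0Pr => e e0.
pose M := nrm (k *: x + y) + (`|k| * nrm x + nrm y) + 1.
have N0 z : 0 <= nrm z by exact: si_norm_ge0.
have M0 : 0 < M by rewrite ltr_wpDl // !addr_ge0 // mulr_ge0.
have [v hv] := cplP f (divr_gt0 e0 M0).
set d := e / M in hv.
have -> : f (k *: x + y) - (Num.conj k * f x + f y) =
    (f (k *: x + y) - B v (k *: x + y)) -
    (Num.conj k * (f x - B v x) + (f y - B v y)).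
  by rewrite si_linearr; ring.
rewrite add0r (le_trans (ler_normB _ _)) //.
have -> : e = d * M by rewrite divfK ?gt_eqF.
rewrite /M [leRHS]mulrDr mulr1 ler_wpDr ?(ltW (divr_gt0 e0 M0)) //.
rewrite [leRHS]mulrDr lerD ?hv // (le_trans (ler_normD _ _)) //.
rewrite [leRHS]mulrDr lerD ?hv //.
by rewrite normrM norm_conjC mulrCA ler_wpM2l // hv.
Qed.

End Completion.

Section ComplexLimits.
Context (R : realType).

Lemma real_cauchy_lim (T : Type) (F : set_system T) {FF : ProperFilter F}
    (g : T -> R) :
  (forall e : R, 0 < e -> exists c, \forall x \near F, `|c - g x| < e) ->
  exists l, forall e : R, 0 < e -> \forall x \near F, `|l - g x| <= e.
Proof.
move=> Fg; have /cvg_ex[l gl] : cvg (g @ F).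
  by apply: R_complete; apply: cauchy_exP => e /Fg[c hc]; exists c.
by exists l; apply/cvgrPdist_le.
Qed.

(** The real and imaginary parts are Cauchy as well. *)
Lemma complex_cauchy_lim (T : Type) (F : set_system T) {FF : ProperFilter F}
    (g : T -> R[i]) :
  (forall e : R[i], 0 < e -> exists c, \forall x \near F, `|c - g x| < e) ->
  exists l, forall e : R[i], 0 < e -> \forall x \near F, `|l - g x| <= e.
Proof.
move=> Fg.
have [a ha] : exists l, forall e : R, 0 < e ->
    \forall x \near F, `|l - complex.Re (g x)| <= e.
  apply: real_cauchy_lim => e e0; have [|c hc] := Fg e%:C; first by rewrite ltcR.
  exists (complex.Re c); apply: filterS hc => x; rewrite -ltcR.
  apply: le_lt_trans; have := normc_ge_Re (c - g x).
  by case: c (g x) => ? ? [? ?].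
have [b hb] : exists l, forall e : R, 0 < e ->
    \forall x \near F, `|l - complex.Im (g x)| <= e.
  apply: real_cauchy_lim => e e0; have [|c hc] := Fg e%:C; first by rewrite ltcR.
  exists (complex.Im c); apply: filterS hc => x; rewrite -ltcR.
  apply: le_lt_trans; have := normc_ge_Re ((c - g x) * 'i%C).
  rewrite normrM [`|'i%C|](_ : _ = 1) ?mulr1; last exact: normCi.
  by rewrite ReiNIm normrN; case: c (g x) => ? ? [? ?].
exists (a +i* b) => e e0.
have eE := nneg_realE (ltW e0).
have e2 : 0 < complex.Re e / 2 by rewrite divr_gt0 // -ltcR -eE.
apply: filterS2 (ha _ e2) (hb _ e2) => x; case: (g x) => c d /= hc hd.
rewrite [_ - _](_ : _ = (a - c)%:C + 'i%C * (b - d)%:C); last first.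
  rewrite [RHS]/= /real_complex_def; apply/eqP; rewrite eq_complex /=.
  by apply/andP; split; apply/eqP; ring.
rewrite (le_trans (ler_normD _ _)) // normrM.
rewrite [`|'i%C|](_ : _ = 1) ?mul1r; last exact: normCi.
rewrite !normc_def /= !expr0n /= !addr0 !sqrtr_sqr eE -rmorphD.
by rewrite lecR [leRHS]splitr lerD.
Qed.

End ComplexLimits.

Section CompletionComplete.
Context (R : realType) (V : lmodType R[i]) (B : semi_inner V).
Local Notation H := (completion B).
Local Notation nrm := (si_norm B).

(** A Cauchy filter converges pointwise, uniformly on bounded sets; the
    pointwise limit is then approximable, and a limit in norm. *)
Lemma completion_cauchy_cvg (F : set_system H) :
  ProperFilter F -> cauchy F -> cvg F.
Proof.
move=> FF /cauchyP Fc.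
have {}Fc (e : R[i]) : 0 < e -> exists f : H, F (fun g => `|f - g| < e).
  by move=> /Fc[f hf]; exists f.
have Fev (u : V) : exists l, forall e : R[i], 0 < e ->
    \forall f \near F, `|l - (f : H) u| <= e.
  apply: complex_cauchy_lim => e e0.
  have nu : 0 < nrm u + 1 by rewrite ltr_wpDl ?si_norm_ge0.
  have [f hf] := Fc (e / (nrm u + 1)) (divr_gt0 e0 nu).
  exists (f u); apply: filterS hf => g fg.
  rewrite -[_ - _]/((f - g) u) (le_lt_trans (cpl_normP _ _)) //.
  rewrite (@le_lt_trans _ _ (cpl_norm (f - g) * (nrm u + 1))) -?ltr_pdivlMr //.
  by rewrite ler_wpM2l ?cpl_norm_ge0 // lerDl.
pose l u := projT1 (cid (Fev u)).
have lP u := projT2 (cid (Fev u)); rewrite -/l in lP.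
have near_l (f : H) (e : R[i]) : F (fun g => `|f - g| < e) ->
    forall u, `|f u - l u| <= e * nrm u.
  move=> Ff u; apply/ler_addgt0Pr => d d0.
  have [g [fg gl]] := filter_ex (filterI Ff (lP u d d0)).
  rewrite (le_trans (ler_distD (g u) _ _)) // lerD //; last by rewrite distrC.
  rewrite -[_ - _]/((f - g) u) (le_trans (cpl_normP _ _)) //.
  by rewrite ler_wpM2r ?si_norm_ge0 // ltW.
have lH : l \in approximable_pred B.
  apply/asboolP => e e0; have e2 := divr_gt0 e0 (ltr0Sn _ 1).
  have [f hf] := Fc _ e2; have [v hv] := cplP f e2.
  exists v => u; rewrite (le_trans (ler_distD (f u) _ _)) //.
  by rewrite [e in leRHS]splitr mulrDl lerD // distrC (near_l _ _ hf).
suff Fl : (fun g : H => g) @ F --> (Completion lH : H) by exact: (cvgP _ Fl).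
apply/cvgrPdist_le => e e0.
have e2 := divr_gt0 e0 (ltr0Sn _ 1).
have [f hf] := Fc _ e2; apply: (filterS _ hf) => g fg.
rewrite (le_trans (ler_distD f _ _)) // [leRHS]splitr lerD ?(ltW fg) //.
rewrite distrC cpl_normE; apply: cpl_norm_le; first exact: ltW.
exact: near_l hf.
Qed.

HB.instance Definition _ := Uniform_isComplete.Build H completion_cauchy_cvg.

Lemma embed_approximable v : B v \in approximable_pred B.
Proof.
apply/asboolP => e e0; exists v => u.
by rewrite subrr normr0 mulr_ge0 ?si_norm_ge0 // ltW.
Qed.

Definition embed v : H := Completion (embed_approximable v).

Lemma embed_is_linear : linear embed.
Proof. by move=> a x y; apply: cpl_eq => u /=; rewrite si_linearl. Qed.

HB.instance Definition _ := GRing.isLinear.Build R[i] V H _ embed embed_is_linear.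

(** Cauchy-Schwarz gives one inequality, evaluation at [v] the other. *)
Lemma norm_embed v : `|embed v| = nrm v.
Proof.
rewrite cpl_normE; apply/eqP; rewrite eq_le cpl_norm_le ?si_norm_ge0 //=; last first.
  by move=> u; exact: si_CauchySchwarz_sqrt.
have := cpl_normP (embed v) v.
rewrite /= -si_normK ger0_norm ?exprn_ge0 ?si_norm_ge0 // expr2.
have [->|v0] := eqVneq (nrm v) 0; first by rewrite cpl_norm_ge0.
by rewrite ler_pM2r // lt_def v0 si_norm_ge0.
Qed.

Lemma cpl_dense (f : H) (e : R[i]) : 0 < e -> exists v, `|f - embed v| <= e.
Proof.
move=> e0; have [v hv] := cplP f e0; exists v.
by rewrite cpl_normE; apply: cpl_norm_le; [exact: ltW|exact: hv].
Qed.

End CompletionComplete.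

(** * Inner products from norms *)

Section Polarization.
Context (C : numClosedFieldType) (V : normedModType C).

(** In an inner product space this is the inner product. As it is an expression
    in the norm, it is continuous, and it makes sense before an inner product is
    known to exist. *)
Definition polar (x y : V) : C :=
  (`|x + y| ^+ 2 - `|x - y| ^+ 2
   + 'i * `|x + 'i *: y| ^+ 2 - 'i * `|x - 'i *: y| ^+ 2) / 4.

Lemma cvg_polar (x y : nat -> V) a b : x @ \oo --> a -> y @ \oo --> b ->
  (fun n => polar (x n) (y n)) @ \oo --> polar a b.
Proof.
move=> xa yb; rewrite /polar.
have sq (u : nat -> V) c : u @ \oo --> c ->
    (fun n => `|u n| ^+ 2) @ \oo --> `|c| ^+ 2.
  by move=> uc; rewrite expr2; apply: cvgM; apply: cvg_norm.
apply: cvgMr_tmp.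
apply: cvgB; first apply: cvgD; first apply: cvgB.
- by apply: sq; apply: cvgD.
- by apply: sq; apply: cvgB.
- by apply: cvgMl_tmp; apply: sq; apply: cvgD => //; apply: (cvgZ (cvg_cst _)).
- by apply: cvgMl_tmp; apply: sq; apply: cvgB => //; apply: (cvgZ (cvg_cst _)).
Qed.

(** Applied to sequences in a dense subspace on which [polar] is an inner
    product, this makes [polar] linear everywhere. *)
Lemma polar_linear_lim (x y z : nat -> V) f g h a :
  x @ \oo --> f -> y @ \oo --> g -> z @ \oo --> h ->
  (forall n, polar (a *: x n + y n) (z n) =
    a * polar (x n) (z n) + polar (y n) (z n)) ->
  polar (a *: f + g) h = a * polar f h + polar g h.
Proof.
move=> xf yg zh xyz.
have xyfg : (fun n => a *: x n + y n) @ \oo --> a *: f + g.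
  by apply: cvgD => //; apply: (cvgZ (cvg_cst _)).
have := cvg_polar xyfg zh; under eq_fun do rewrite xyz.
have : (fun n => a * polar (x n) (z n) + polar (y n) (z n)) @ \oo
    --> a * polar f h + polar g h.
  by apply: cvgD; first apply: cvgMl_tmp; exact: cvg_polar.
move=> c1 c2; exact: (cvg_unique _ c2 c1).
Qed.

Lemma polar_conj x y : polar y x = Num.conj (polar x y).
Proof.
have ii : 'i * 'i = -1 :> C by rewrite -expr2 sqrCi.
have e1 : `|y + 'i *: x| = `|x - 'i *: y|.
  have -> : y + 'i *: x = 'i *: (x - 'i *: y).
    by rewrite scalerBr scalerA ii scaleN1r opprK addrC.
  by rewrite normrZ normCi mul1r.
have e2 : `|y - 'i *: x| = `|x + 'i *: y|.
  have -> : y - 'i *: x = (- 'i) *: (x + 'i *: y).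
    by rewrite scalerDr scalerA mulNr ii opprK scale1r scaleNr addrC.
  by rewrite normrZ normrN normCi mul1r.
rewrite /polar e1 e2 (addrC y) (distrC y) !(rmorphM, rmorphB, rmorphD, rmorphXn) /=.
rewrite fmorphV conjCi rmorph_nat !(geC0_conj (normr_ge0 _)).
by field.
Qed.

Lemma polar_diag x : polar x x = `|x| ^+ 2.
Proof.
have e1 : `|x + 'i *: x| ^+ 2 = 2 * `|x| ^+ 2.
  rewrite -[X in X + _]scale1r -scalerDl normrZ exprMn normCK.
  rewrite rmorphD rmorph1 /= conjCi.
  by rewrite mulrDl mul1r mulrBr mulr1 -expr2 sqrCi; ring.
have e2 : `|x - 'i *: x| ^+ 2 = 2 * `|x| ^+ 2.
  rewrite -[X in X - _]scale1r -scalerBl normrZ exprMn normCK.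
  rewrite rmorphB rmorph1 /= conjCi.
  by rewrite opprK mulrBl mul1r mulrDr mulr1 -expr2 sqrCi; ring.
rewrite /polar e1 e2 subrr normr0 -mulr2n normrMn.
by field.
Qed.

End Polarization.

Lemma polar_eq_lim (C : numClosedFieldType) (V W : normedModType C)
    (x y : nat -> V) a b (x' y' : nat -> W) a' b' :
  x @ \oo --> a -> y @ \oo --> b -> x' @ \oo --> a' -> y' @ \oo --> b' ->
  (forall n, polar (x n) (y n) = polar (x' n) (y' n)) -> polar a b = polar a' b'.
Proof.
move=> xa yb xa' yb' e; have := cvg_polar xa yb; under eq_fun do rewrite e.
move=> c1; exact: (cvg_unique _ c1 (cvg_polar xa' yb')).
Qed.

Section Sequences.
Context (R : realType) (V : normedModType R[i]).

(** A positive [e] in [R[i]] is real, so the archimedean property of [R] gives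
    the rank from which [1/(k+1)] is at most [e]. *)
Lemma cvg_dist_harmonic (x : nat -> V) l :
  (forall k, `|l - x k| <= (k.+1%:R)^-1) -> x @ \oo --> l.
Proof.
move=> hx; apply/cvgrPdist_le => e e0.
have eE := nneg_realE (ltW e0).
have e1 : 0 < complex.Re e by rewrite -ltcR -eE.
exists (Num.Def.archi_bound (complex.Re e)^-1) => // k /= hk.
rewrite (le_trans (hx k)) // eE.
rewrite (_ : k.+1%:R = (k.+1%:R : R)%:C); last by rewrite rmorph_nat.
rewrite -fmorphV lecR invf_ple ?posrE //.
rewrite (le_trans (ltW (archi_boundP _))) ?invr_ge0 ?(ltW e1) //.
by rewrite ler_nat (leq_trans hk).
Qed.

Lemma closure_range_seq (T : Type) (h : T -> V) x : closure (range h) x ->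
  exists t : nat -> T, (h \o t) @ \oo --> x.
Proof.
move=> hx; have ex k : exists t, `|x - h t| <= (k.+1%:R)^-1.
  have [|_ [[t _ <-]]] := hx (ball x (k.+1%:R)^-1).
    by apply: nbhsx_ballx; rewrite invr_gt0.
  by rewrite -ball_normE /= => /ltW ht; exists t.
by have [t ht] := choice ex; exists t; exact: cvg_dist_harmonic.
Qed.

End Sequences.

Section CompletionDot.
Context (R : realType) (V : lmodType R[i]) (B : semi_inner V).
Local Notation H := (completion B).
Local Notation C := R[i].

Definition cpl_dot (f g : H) : C := polar f g.

Lemma cpl_dot_embed v u : cpl_dot (embed B v) (embed B u) = B v u.
Proof.
rewrite /cpl_dot /polar -!linearZ -!linearB -!linearD !norm_embed !si_normK.
exact/esym/si_polarization.
Qed.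

Lemma embed_seq (f : H) : exists v : nat -> V, (embed B \o v) @ \oo --> f.
Proof.
have ex k : exists v, `|f - embed B v| <= (k.+1%:R)^-1.
  by apply: cpl_dense; rewrite invr_gt0.
by have [t ht] := choice ex; exists t; exact: cvg_dist_harmonic.
Qed.

Lemma cpl_dot_linearl a f g h :
  cpl_dot (a *: f + g) h = a * cpl_dot f h + cpl_dot g h.
Proof.
have [v hv] := embed_seq f; have [u hu] := embed_seq g.
have [w hw] := embed_seq h.
apply: (polar_linear_lim hv hu hw) => n /=.
by rewrite -linearP -!/(cpl_dot _ _) !cpl_dot_embed si_linearl.
Qed.

Lemma cpl_dot_conj f g : cpl_dot f g = Num.conj (cpl_dot g f).
Proof. exact: polar_conj. Qed.

Lemma cpl_dot_linearr h a f g :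
  cpl_dot h (a *: f + g) = Num.conj a * cpl_dot h f + cpl_dot h g.
Proof.
have conjP (x y z : C) :
    Num.conj (x * y + z) = Num.conj x * Num.conj y + Num.conj z.
  by rewrite rmorphD rmorphM.
rewrite [LHS]cpl_dot_conj (cpl_dot_linearl a f g h) conjP.
by congr (_ * _ + _); rewrite [RHS]cpl_dot_conj.
Qed.

Lemma cpl_dot_bilinear :
  bilinear_for (GRing.Scale.Law.clone _ _ *%R _)
    (GRing.Scale.Law.clone _ _ (Num.conj \; *%R) _) cpl_dot.
Proof.
by split=> [h a f g|h a f g]; rewrite (cpl_dot_linearl, cpl_dot_linearr).
Qed.

Lemma cpl_dot_hermitian f g :
  cpl_dot f g = (-1) ^+ false * Num.conj (cpl_dot g f).
Proof. by rewrite mul1r -cpl_dot_conj. Qed.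

Lemma cpl_dot_gt0 f : f != 0 -> 0 < cpl_dot f f.
Proof. by move=> f0; rewrite /cpl_dot polar_diag exprn_gt0 // normr_gt0. Qed.

HB.instance Definition _ :=
  bilinear_isBilinear.Build C H H C _ _ cpl_dot cpl_dot_bilinear.
HB.instance Definition _ :=
  @isHermitianSesquilinear.Build C H false Num.conj cpl_dot cpl_dot_hermitian.
HB.instance Definition _ := isDotProduct.Build C H cpl_dot cpl_dot_gt0.

Definition completion_hilbert : hilbertType R :=
  @HilbertType R H cpl_dot (fun f => esym (polar_diag f)).

End CompletionDot.

(** * Existence of GNS representations *)

Section IteratedBound.
Context (R : realType).

(** With [y k := x k / b] the hypotheses give [y 0 ^ (2 ^ k) <= y k], which
    grows at most like [q ^ (2 ^ k)]; so [y 0 > q] is impossible. *)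
Lemma iterated_square_bound (x : nat -> R) (b K q : R) :
  0 <= b -> 0 <= q -> (forall k, 0 <= x k) ->
  (forall k, x k ^+ 2 <= b * x k.+1) -> (forall k, x k <= K * q ^+ (2 ^ k)) ->
  x 0%N <= b * q.
Proof.
move=> b0 q0 x0 xS xK.
move: b0; rewrite le_eqVlt => /predU1P[b0|b0].
  by have := xS 0%N; rewrite -b0 !mul0r expr2 => h; have := x0 0%N; nra.
pose y k := x k / b.
have y0 k : 0 <= y k by rewrite divr_ge0 // ltW.
have yP k : y 0%N ^+ (2 ^ k) <= y k.
  elim: k => [|k IH]; first by rewrite expr1.
  rewrite expnSr exprM; apply: (@le_trans _ _ (y k ^+ 2)).
    by rewrite ler_pXn2r ?nnegrE ?exprn_ge0 ?y0.
  rewrite /y expr_div_n ler_pdivrMr ?exprn_gt0 //.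
  by rewrite (_ : _ / b * _ = b * x k.+1) //; field; rewrite gt_eqF.
rewrite -ler_pdivrMl // mulrC -/(y 0%N) leNgt; apply/negP => qy.
have yK k : y 0%N ^+ (2 ^ k) <= K / b * q ^+ (2 ^ k).
  by rewrite (le_trans (yP k)) // /y mulrAC ler_pM2r ?invr_gt0.
move: q0; rewrite le_eqVlt => /predU1P[q0|q0].
  have := yK 0%N; rewrite -q0 !expr1 mulr0 => h.
  by move: qy; rewrite -q0 ltNge h.
(* (1 + r) ^ (2 ^ k) would be bounded, against Bernoulli's inequality *)
pose r := y 0%N / q - 1.
have r0 : 0 < r by rewrite subr_gt0 ltr_pdivlMr // mul1r.
have bern n : 1 + n%:R * r <= (1 + r) ^+ n.
  elim: n => [|n IH]; first by rewrite mul0r addr0 expr0.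
  rewrite exprSr (le_trans (_ : _ <= (1 + n%:R * r) * (1 + r))) //.
    by rewrite -natr1; have : 0 <= n%:R :> R by []; nra.
  by rewrite ler_pM2r // ltr_wpDl // ltW.
have rK k : k%:R * r <= K / b.
  have := yK k; rewrite -ler_pdivrMr ?exprn_gt0 // -expr_div_n.
  have -> : y 0%N / q = 1 + r by rewrite /r addrC subrK.
  move=> /(le_trans (bern _)); apply: le_trans.
  rewrite ler_wpDl // ler_pM2r // ler_nat ltnW //.
  exact: ltn_expl.
have := rK (Num.Def.archi_bound (K / b / r)).
rewrite leNgt -ltr_pdivrMr // => /negP; apply.
apply: archi_boundP; rewrite divr_ge0 ?(ltW r0) //.
by have := rK 0%N; rewrite mul0r.
Qed.

End IteratedBound.

Section StarAlgebra.
Context (R : realType) (A : cstarAlg R).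

(** The adjoint of a left unit is a right unit. *)
Lemma cs_star1 : (cs_one : A)^*c = cs_one.
Proof.
have e : (cs_one : A)^*c = (cs_one : A)^*c *c cs_one by rewrite cs_mul1r.
have : (cs_one : A)^*c = (cs_one : A)^*c^*c.
  by rewrite [RHS](congr1 (@cs_star _ A) e) cs_starM cs_starK cs_mul1r.
by rewrite cs_starK.
Qed.

Variable w : state A.

Lemma gns_form_linearl (a : R[i]) (x y z : A) :
  w (z^*c *c (a *: x + y)) = a * w (z^*c *c x) + w (z^*c *c y).
Proof. by rewrite cs_linear_mulr linearP. Qed.

Lemma gns_form_linearr (a : R[i]) (x y z : A) :
  w ((a *: x + y)^*c *c z) = Num.conj a * w (x^*c *c z) + w (y^*c *c z).
Proof. by rewrite cs_starD cs_starZ cs_linear_mull linearP. Qed.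

Definition gns_form : semi_inner A :=
  @SemiInner R A (fun a b => w (b^*c *c a))
    gns_form_linearl gns_form_linearr (st_ge0 w).

Lemma gns_form_adj a x y : gns_form (a *c x) y = gns_form x (a^*c *c y).
Proof. by rewrite /= cs_starM cs_starK cs_mulA. Qed.

(** Put [c := a^* a] and let [c_k] be its [2^k]-th power, which is selfadjoint.
    Cauchy-Schwarz for [c_k x] and [x] bounds [|w (x^* c_k x)|^2] by
    [w (x^* x) w (x^* c_(k+1) x)], while [|w (x^* c_k x)|] is at most
    [|x^*| |x| |c|^(2^k)], since [w] has norm one. *)
Lemma gns_form_bound a x :
  gns_form (a *c x) (a *c x) <= `|a^*c *c a| * gns_form x x.
Proof.
pose c := a^*c *c a.
pose sq k := iter k (fun d => d *c d) c.
have sqT k : (sq k)^*c = sq k.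
  by elim: k => [|k IH] /=; rewrite cs_starM ?cs_starK // IH.
have sq_norm k : `|sq k| <= `|c| ^+ (2 ^ k).
  elim: k => [|k IH] /=; first by rewrite expr1.
  by rewrite (le_trans (cs_normM _ _)) // expnSr exprM expr2 ler_pM.
have cE : gns_form (sq 0%N *c x) x = gns_form (a *c x) (a *c x).
  by rewrite /= cs_starM !cs_mulA.
rewrite -cE.
pose b := complex.Re (gns_form x x).
have bE : gns_form x x = b%:C by apply: nneg_realE; exact: si_ge0.
pose q := complex.Re `|c|.
have qE : `|c| = q%:C by exact: nneg_realE.
pose y k := complex.Re `|gns_form (sq k *c x) x|.
have yE k : `|gns_form (sq k *c x) x| = (y k)%:C by exact: nneg_realE.
pose K := complex.Re (`|x^*c| * `|x|).
have KE : `|x^*c| * `|x| = K%:C by apply: nneg_realE; rewrite mulr_ge0.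
have key : y 0%N <= b * q.
  apply: (@iterated_square_bound R y b K q).
  - by rewrite -ler0c -bE si_ge0.
  - by rewrite -ler0c -qE.
  - by move=> k; rewrite -ler0c -yE.
  - move=> k; rewrite -lecR rmorphXn rmorphM /= -yE -bE -yE.
    rewrite (le_trans (si_CauchySchwarz _ _ _)) // mulrC ler_wpM2l ?si_ge0 //.
    have e : gns_form (sq k *c x) (sq k *c x) = gns_form (sq k.+1 *c x) x.
      by rewrite /= cs_starM sqT !cs_mulA.
    by rewrite -e real_ler_norm // ger0_real // si_ge0.
  - move=> k; rewrite -lecR rmorphM rmorphXn /= -yE -KE -qE.
    rewrite (le_trans (st_norm _ _)) // (le_trans (cs_normM _ _)) //.
    by rewrite -mulrA ler_wpM2l // (le_trans (cs_normM _ _)) // mulrC ler_wpM2l.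
rewrite qE bE -rmorphM mulrC (le_trans (_ : _ <= (y 0%N)%:C)) ?lecR //.
by rewrite -yE real_ler_norm // ger0_real // cE si_ge0.
Qed.

End StarAlgebra.

Section GNSExistence.
Context (R : realType) (A : cstarAlg R) (w : state A).
Local Notation B := (gns_form w).
Local Notation H := (completion B).
Local Notation nrm := (si_norm B).

Lemma gns_norm_mul a x : nrm (a *c x) <= `|a| * nrm x.
Proof.
rewrite -(@ler_pXn2r _ 2) ?nnegrE ?mulr_ge0 ?si_norm_ge0 //.
by rewrite exprMn !si_normK -cs_norm_star gns_form_bound.
Qed.

Lemma gns_op_approximable a (f : H) :
  (fun x => f (a^*c *c x)) \in approximable_pred B.
Proof.
apply/asboolP => e e0.
have a1 : 0 < `|a^*c| + 1 by rewrite ltr_wpDl.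
have [v hv] := cplP f (divr_gt0 e0 a1); exists (a *c v) => u.
rewrite gns_form_adj (le_trans (hv _)) // -mulrA ler_wpM2l ?(ltW e0) //.
rewrite ler_pdivrMl // (le_trans (gns_norm_mul _ _)) //.
by rewrite ler_wpM2r ?si_norm_ge0 // lerDl.
Qed.

(** If [f] is the functional of a vector [xi], then [<a xi, x> = <xi, a^* x>]
    is the value of [f] at [a^* x]. *)
Definition gns_op a (f : H) : H := Completion (gns_op_approximable a f).

Lemma gns_op_is_linear a : linear (gns_op a).
Proof. by move=> k f g; apply: cpl_eq. Qed.

HB.instance Definition _ a :=
  GRing.isLinear.Build R[i] H H _ (gns_op a) (gns_op_is_linear a).

Lemma gns_op_continuous a : continuous (gns_op a).
Proof.
apply: (@bounded_linear_continuous _ H H (gns_op a)).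
apply/bounded_funP => r; exists (`|a^*c| * r) => f fr.
rewrite cpl_normE; apply: cpl_norm_le => [|u].
  by rewrite mulr_ge0 // (le_trans _ fr).
rewrite (le_trans (cpl_normP f _)) // mulrAC [leRHS]mulrC.
by rewrite ler_pM ?cpl_norm_ge0 ?si_norm_ge0 ?gns_norm_mul.
Qed.

(** Passing to [a^*] and evaluating [f] are both antilinear. *)
Lemma gns_op_linear_alg f : linear (fun a => gns_op a f).
Proof.
move=> k a b; apply: cpl_eq => u.
rewrite [LHS]/= cs_starD cs_starZ cs_linear_mull cpl_antilinear conjCK.
by [].
Qed.

Lemma gns_op_mul a b f : gns_op (a *c b) f = gns_op a (gns_op b f).
Proof. by apply: cpl_eq => u /=; rewrite cs_starM cs_mulA. Qed.

Lemma gns_op_one f : gns_op cs_one f = f.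
Proof. by apply: cpl_eq => u /=; rewrite cs_star1 cs_mul1l. Qed.

Lemma gns_op_embed a v : gns_op a (embed B v) = embed B (a *c v).
Proof. by apply: cpl_eq => u; rewrite -[RHS]/(B (a *c v) u) gns_form_adj. Qed.

Lemma gns_op_star a f g : cpl_dot (gns_op a f) g = cpl_dot f (gns_op a^*c g).
Proof.
have [v hv] := embed_seq f; have [u hu] := embed_seq g.
have op_lim c (x : nat -> A) h : (embed B \o x) @ \oo --> h ->
    (fun n => gns_op c (embed B (x n))) @ \oo --> gns_op c h.
  by move=> xh; exact: (continuous_cvg _ (@gns_op_continuous c h) xh).
apply: (polar_eq_lim (op_lim a _ _ hv) hu hv (op_lim a^*c _ _ hu)) => n /=.
rewrite !gns_op_embed -!/(cpl_dot _ _) !cpl_dot_embed; exact: gns_form_adj.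
Qed.

Definition gns_representation : representation A (completion_hilbert B) :=
  @Representation R A (completion_hilbert B)
    (fun a => gns_op a : {linear H -> H}) gns_op_continuous gns_op_linear_alg
    gns_op_mul gns_op_one gns_op_star.

Lemma gns_rep_cyclic :
  closure (range (fun a => gns_representation a (embed B cs_one))) = setT.
Proof.
rewrite -subTset => f _ U /nbhs_ballP[e e0 fU].
have [v hv] := cpl_dense f (divr_gt0 e0 (ltr0Sn _ 1)).
exists (embed B v); split.
  by exists v => //=; rewrite gns_op_embed cs_mul1r.
apply: fU; rewrite -ball_normE /= (le_lt_trans hv) //.
by rewrite ltr_pdivrMr // ltr_pMr // ltr1n.
Qed.

Lemma gns_rep_state a : w a =
  cpl_dot (gns_representation a (embed B cs_one)) (embed B cs_one).
Proof.
by rewrite /= gns_op_embed cpl_dot_embed /= cs_star1 cs_mul1l cs_mul1r.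
Qed.

Definition gns_exists : gns w := GNS gns_rep_cyclic gns_rep_state.

End GNSExistence.

(** * Uniqueness of GNS representations *)

Section UnitaryEquivalence.
Context (R : realType) (A : cstarAlg R).

Lemma hdot_linearl (H : hilbertType R) a (x y z : H) :
  '[a *: x + y, z] = a * '[x, z] + '[y, z].
Proof. exact: linearPl. Qed.

Lemma hdot_linearr (H : hilbertType R) a (x y z : H) :
  '[z, a *: x + y] = Num.conj a * '[z, x] + '[z, y].
Proof. exact: linearPr. Qed.

Lemma hdot_ge0 (H : hilbertType R) (x : H) : 0 <= '[x, x].
Proof. by rewrite -h_norm_dot exprn_ge0. Qed.

Lemma hdot_polar (H : hilbertType R) (x y : H) : '[x, y] = polar x y.
Proof.
rewrite /polar !h_norm_dot.
exact: (si_polarization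
  (SemiInner (@hdot_linearl H) (@hdot_linearr H) (@hdot_ge0 H))).
Qed.

Lemma unitarily_equivalent_sym (H H' : hilbertType R)
    (p : representation A H) (p' : representation A H') :
  unitarily_equivalent p p' -> unitarily_equivalent p' p.
Proof.
case=> U [Usurj Uiso Up]; have [g gK] := choice Usurj.
have Uinj : injective U.
  apply: raddf_inj => x Ux0; apply/normr0_eq0/eqP; rewrite -sqrf_eq0 h_norm_dot.
  by rewrite -Uiso Ux0 linear0r.
have glin : linear g by move=> a x y; apply: Uinj; rewrite linearP !gK.
pose G : {linear H' -> H} := HB.pack g (GRing.isLinear.Build _ _ _ _ g glin).
exists G; split => [x|x y|a x].
- by exists (U x); apply: Uinj; rewrite gK.
- by rewrite -Uiso !gK.
- by apply: Uinj; rewrite Up !gK.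
Qed.

Lemma unitarily_equivalent_trans (H1 H2 H3 : hilbertType R)
    (p1 : representation A H1) (p2 : representation A H2)
    (p3 : representation A H3) :
  unitarily_equivalent p1 p2 -> unitarily_equivalent p2 p3 ->
  unitarily_equivalent p1 p3.
Proof.
case=> U [Us Ui Up] [W [Ws Wi Wp]]; exists (W \o U); split => [z|x y|a x] /=.
- by have [y <-] := Ws z; have [x <-] := Us y; exists x.
- by rewrite Wi Ui.
- by rewrite Up Wp.
Qed.

Lemma unitarily_equivalent_refl (H : hilbertType R) (p : representation A H) :
  unitarily_equivalent p p.
Proof. by exists idfun; split => // y; exists y. Qed.

Section GNSUniqueness.
Context (w : state A).

Lemma gns_norm (G : gns w) a :
  `|gns_rep G a (gns_vec G)| ^+ 2 = w (a^*c *c a).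
Proof.
by rewrite (gns_state G) h_norm_dot !rep_star -rep_mul cs_starM cs_starK.
Qed.

(** The graph of the intertwiner sending the orbit vector of [a] in [G] to the
    orbit vector of [a] in [G']. Going through sequences in the algebra treats
    [G] and [G'] alike, so that surjectivity is totality of the converse. *)
Definition gns_graph (G G' : gns w) (x : gns_space G) (y : gns_space G') :=
  exists t : nat -> A, (fun n => gns_rep G (t n) (gns_vec G)) @ \oo --> x /\
    (fun n => gns_rep G' (t n) (gns_vec G')) @ \oo --> y.

Lemma gns_orbitP (G : gns w) k a b : gns_rep G (k *: a + b) (gns_vec G) =
  k *: gns_rep G a (gns_vec G) + gns_rep G b (gns_vec G).
Proof. exact: rep_linear. Qed.

Lemma gns_orbit_dist (G G' : gns w) a b :
  `|gns_rep G a (gns_vec G) - gns_rep G b (gns_vec G)| =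
  `|gns_rep G' a (gns_vec G') - gns_rep G' b (gns_vec G')|.
Proof.
have e (K : gns w) : gns_rep K a (gns_vec K) - gns_rep K b (gns_vec K) =
    gns_rep K (a - b) (gns_vec K).
  by rewrite addrC -scaleN1r -gns_orbitP scaleN1r addrC.
by apply/eqP; rewrite -(@eqrXn2 _ 2) // !e !gns_norm.
Qed.

(** Orbit vectors of [a] and [b] have the same distance in [G] and in [G'], so
    one sequence of orbit vectors is Cauchy when the other is. *)
Lemma gns_graph_total G G' x : exists y, @gns_graph G G' x y.
Proof.
have : closure (range (fun a => gns_rep G a (gns_vec G))) x by rewrite gns_cyclic.
move=> /closure_range_seq[t ht].
suff /cvg_ex[y hy] : cvg ((fun n => gns_rep G' (t n) (gns_vec G')) @ \oo).
  by exists y, t.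
apply: cauchy_cvg; apply/cauchy_ballP => e e0.
have /cvg_cauchy /cauchy_ballP /(_ e e0) := cvgP _ ht.
rewrite !near_map2; apply: filterS => -[m n] /=.
by rewrite -!ball_normE /= (gns_orbit_dist G G').
Qed.

Lemma gns_graph_sym G G' x y : @gns_graph G G' x y -> @gns_graph G' G y x.
Proof. by case=> t [tx ty]; exists t. Qed.

Lemma gns_graph_dot G G' x y u v : @gns_graph G G' x y -> @gns_graph G G' u v ->
  '[x, u] = '[y, v].
Proof.
case=> t [tx ty] [r [ru rv]]; rewrite !hdot_polar.
apply: (polar_eq_lim tx ru ty rv) => n; rewrite -!hdot_polar !rep_star -!rep_mul.
have e (K : gns w) a b :
    '[gns_vec K, gns_rep K (a *c b) (gns_vec K)] = w (b^*c *c a^*c).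
  by rewrite -[a *c b in LHS]cs_starK -rep_star -gns_state cs_starM.
by rewrite !e.
Qed.

Lemma gns_graph_linear G G' k x y u v :
  @gns_graph G G' x y -> @gns_graph G G' u v ->
  @gns_graph G G' (k *: x + u) (k *: y + v).
Proof.
case=> t [tx ty] [r [ru rv]]; exists (fun n => k *: t n + r n).
by split; under eq_fun do rewrite gns_orbitP;
  apply: cvgD => //; apply: (cvgZ (cvg_cst _)).
Qed.

Lemma gns_graph_rep G G' a x y : @gns_graph G G' x y ->
  @gns_graph G G' (gns_rep G a x) (gns_rep G' a y).
Proof.
case=> t [tx ty]; exists (fun n => a *c t n).
by split; under eq_fun do rewrite rep_mul;
  apply: (continuous_cvg _ (@rep_bounded _ _ _ _ a _)).
Qed.

(** The difference [z - y] is related to [0], hence has norm [0]. *)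
Lemma gns_graph_fun G G' x y z :
  @gns_graph G G' x y -> @gns_graph G G' x z -> y = z.
Proof.
move=> xy xz; have := gns_graph_linear (-1) xy xz.
rewrite !scaleN1r addNr => h; have := gns_graph_dot h h.
rewrite linear0l => /esym/eqP; rewrite -h_norm_dot sqrf_eq0 normr_eq0.
by rewrite addrC subr_eq0 => /eqP.
Qed.

Theorem gns_unique (G G' : gns w) : unitarily_equivalent (gns_rep G) (gns_rep G').
Proof.
have [f fP] := choice (@gns_graph_total G G').
have flin : linear f.
  move=> k x y; exact: gns_graph_fun (fP _) (gns_graph_linear k (fP x) (fP y)).
pose U : {linear gns_space G -> gns_space G'} :=
  HB.pack f (GRing.isLinear.Build _ _ _ _ f flin).
exists U; split => [y|x y|a x].
- have [x /gns_graph_sym xy] := gns_graph_total G y.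
  by exists x; exact: gns_graph_fun (fP _) xy.
- by rewrite (gns_graph_dot (fP x) (fP y)).
- exact: gns_graph_fun (fP _) (gns_graph_rep a (fP x)).
Qed.

End GNSUniqueness.

Lemma equivalent_refl (w : state A) : equivalent w w.
Proof.
by exists (gns_exists w), (gns_exists w); exact: unitarily_equivalent_refl.
Qed.

Lemma equivalent_sym (w w' : state A) : equivalent w w' -> equivalent w' w.
Proof. by case=> G [G' h]; exists G', G; exact: unitarily_equivalent_sym. Qed.

Lemma equivalent_trans (w1 w2 w3 : state A) :
  equivalent w1 w2 -> equivalent w2 w3 -> equivalent w1 w3.
Proof.
case=> G1 [G2 h12] [G2' [G3 h23]]; exists G1, G3.
apply: unitarily_equivalent_trans h12 _.
exact: unitarily_equivalent_trans (gns_unique G2 G2') h23.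
Qed.

End UnitaryEquivalence.

(** * Minimal models *)

Lemma leinf_anti m n : leinf m n -> leinf n m -> m = n.
Proof. by case: m n => [a|] [b|] //= ab ba; congr Some; apply/anti_leq/andP. Qed.

Lemma is_min_exists (S : set natinf) d : S d -> exists m, is_min S m.
Proof.
move=> Sd; have [[k Sk]|noS] := pselect (exists k, S (Some k)); last first.
  exists None; split=> [|[k|] Sk //]; last by case: noS; exists k.
  by case: d Sd => // k Sk; case: noS; exists k.
have ex : exists k, `[< S (Some k) >] by exists k; apply/asboolP.
case: (ex_minnP ex) => m /asboolP Sm mP; exists (Some m).
split=> // -[j|] //= Sj.
by apply: mP; apply/asboolP.
Qed.

Lemma kappa_eq (R : realType) (n : natinf) (A : cstarAlg R) (s : idx n -> A)
    (w w' : state A) :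
  equivalent w w' -> kappa s w = kappa s w'.
Proof.
move=> ww'; rewrite /kappa.
rewrite (_ : [set v | equivalent v w] = [set v | equivalent v w']) //.
apply/seteqP; split=> v /= vw; first exact: equivalent_trans vw ww'.
exact: equivalent_trans vw (equivalent_sym ww').
Qed.

Theorem theorem1p1 (R : realType) (n : natinf) (A : cstarAlg R)
    (s : idx n -> A) (hn : leinf (Some 2%N) n) (hs : is_cuntz_algebra s) :
  (forall w : state A, exists w' : state A, minimal s w' /\ equivalent w' w) /\
  (forall w w' : state A, equivalent w w' -> kappa s w = kappa s w').
Proof.
split=> [w|w w']; last exact: kappa_eq.
pose S := [set cdim s w' | w' in [set w' | equivalent w' w]].
have Sw : S (cdim s w) by exists w => //; exact: equivalent_refl.
have [m mS] := is_min_exists Sw.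
have [w' w'w w'm] := mS.1; exists w'; split => //.
rewrite /minimal (kappa_eq s w'w) w'm; apply/esym; apply: xget_unique => // k kS.
by apply: leinf_anti; [apply: kS.2; exact: mS.1|apply: mS.2; exact: kS.1].
Qed.
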